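(* Let $I=\{a_1<a_2<\dots<a_d\}$ be a proper subset of $[n]$ with $d\ge2$, and set $k=a_1-1$, $l=n-a_d$. Then \[ p_n(I)=(-1)^{k+1}\sum_{i=0}^{l}\binom{k+i}{i}\,p_{n-k-1-i}(D)\,x_{n-k-i}\;+\;\sum_{j=0}^{k}(-1)^j\binom{l+j}{j}\,p_{n-l-1-j}(D_j)\,x_{n-l-j}, \] where $D=\{a_2-a_1,a_3-a_1,\dots,a_d-a_1\}$ and $D_j=\{a_1-j,a_2-j,\dots,a_{d-1}-j\}$ for $j=0,\dots,k$.
   Context: $[n]=\{1,\dots,n\}$. Let $\zeta_n$ be the permutation of $[n]$ with $\zeta_n(1)=n$ and $\zeta_n(j)=j-1$ for $2\le j\le n$. The Pascal descent polynomials $p_n(I)\in\mathbb{Z}[x_1,x_2,\dots]$ (commuting variables), for $n\ge1$ and nonempty $I\subseteq[n]$, are defined recursively by $p_n(\{i\})=(-1)^{i-1}\binom{n-1}{i-1}$, and for $|I|\ge2$: $p_n(I)=\hat p_{n-1}(I)-\hat p_{n-1}(\zeta_n(I))$, where for $J\subseteq[n]$ with $|J|\ge2$ one sets $\hat p_{n-1}(J)=p_{n-1}(J)$ if $n\notin J$ and $\hat p_{n-1}(J)=p_{n-1}(J\setminus\{n\})\,x_n$ if $n\in J$. (For $n\ge2$, $p_n(I)$ equals $h_n(I)/(x_1-x_2)$, where $h_n(I)$ is the commutative image of the left normed multilinear Lie bracketing acting on the two-block set partition with second block $I$.) *)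

(* Defs.v *)
From HB Require Import structures.
From mathcomp Require Import all_boot all_order all_algebra.
From mathcomp Require Import finmap.
From mathcomp.multinomials Require Import monalg.

Set Implicit Arguments.
Unset Strict Implicit.
Unset Printing Implicit Defensive.

Import GRing.Theory.
Local Open Scope fset_scope.
Local Open Scope ring_scope.

(* The indeterminates are indexed by nat, so there is a spare one of index 0;
   it never occurs in the polynomials below. *)
Definition zpoly := {malg int[{cmonom nat}]}.

Definition xvar (i : nat) : zpoly := << ucm i >>.

Definition natset (n : nat) : {fset nat} := [fset i in index_iota 1 n.+1].

(* Only meaningful on {1, ..., n}. *)
Definition zeta (n j : nat) : nat := if j == 1%N then n else j.-1.

(* Only meaningful for 0 < n and I a nonempty subset of {1, ..., n}: the values
   for n = 0 or I empty are junk. On such arguments, failing to be a singleton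
   means having at least two elements, and the recursive calls are again on
   meaningful arguments. *)
Fixpoint pascal_descent (n : nat) (I : {fset nat}) : zpoly :=
  if n is m.+1 then
    if enum_fset I is [:: i] then (-1) ^+ (i - 1) * 'C(n - 1, i - 1)%:R
    else
      let hat (J : {fset nat}) :=
        if n \in J then pascal_descent m (J `\ n) * xvar n
        else pascal_descent m J in
      hat I - hat [fset zeta n j | j in I]
  else 0.

(* Main.v *)
(** Translate [I] so that its least element becomes [0], giving a set [C] with
    maximum [m]; then [p_n(I)] depends only on the gaps [k] and [l] to the left
    and to the right of [I] in [[n]].  One step of the recursion reads
    [F (k+1) (l+1) = F (k+1) l - F k (l+1)], while on the boundary [k = 0]
    (resp. [l = 0]) the subtracted (resp. first) term drops the minimum (resp.
    maximum) of [I] and leaves a factor [x_n].  Unrolling this signed Pascal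
    recurrence from its boundary values gives the two binomial sums. *)
Require Import Defs.
From mathcomp Require Import all_boot all_order all_algebra.
From mathcomp Require Import finmap.
From mathcomp.multinomials Require Import monalg.
From mathcomp Require Import zify ring.

Local Open Scope fset_scope.
Local Open Scope ring_scope.

Import GRing.Theory.

(** Each coefficient counts lattice paths from [(k, l)], where a step lowering the first coordinate
    has weight [-1] and one lowering the second has weight [1]. A path leaving from [(0, l - i)]
    contributes [- u (l - i)] after [k] signed and [i] unsigned steps; one leaving from [(k - j, 0)]
    contributes [v (k - j)] after [j] signed and [l] unsigned steps. *)
Lemma signed_pascal_recurrence (R : comNzRingType) (F : nat -> nat -> R)
    (u v : nat -> R) :
  F 0 0 = v 0 - u 0 ->
  (forall k, F k.+1 0 = v k.+1 - F k 0) ->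
  (forall l, F 0 l.+1 = F 0 l - u l.+1) ->
  (forall k l, F k.+1 l.+1 = F k.+1 l - F k l.+1) ->
  forall k l, F k l =
    (-1) ^+ k.+1 * \sum_(0 <= i < l.+1) 'C(k + i, i)%:R * u (l - i)%N
    + \sum_(0 <= j < k.+1) (-1) ^+ j * 'C(l + j, j)%:R * v (k - j)%N.
Proof.
move=> F00 Fk0 F0l Fkl; elim=> [|k IHk]; elim=> [|l IHl].
- by rewrite F00 !big_nat1 !bin0 !subn0 expr0 expr1; ring.
- rewrite F0l IHl [X in _ = _ * X + _]big_nat_recl // !big_nat1 !bin0 expr1 subn0.
  under [X in _ = _ * (_ + X) + _]eq_bigr => i _ do rewrite add0n binn subSS.
  under [X in _ * X + _ - _]eq_bigr => i _ do rewrite add0n binn.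
  by ring.
- rewrite Fk0 IHk [X in _ = _ + X]big_nat_recl // !big_nat1 !bin0 !subn0.
  under [X in _ = _ + (_ + X)]eq_bigr => j _ do
    rewrite add0n binn subSS exprS -!mulrA mulN1r.
  under [X in _ - (_ + X)]eq_bigr => j _ do rewrite add0n binn -!mulrA.
  by rewrite sumrN [in RHS]exprS expr0; ring.
- rewrite Fkl IHl IHk.
  rewrite [X in _ = _ * X + _]big_nat_recl // [X in _ = _ + X]big_nat_recl //.
  rewrite [X in _ - (_ * X + _)]big_nat_recl // [X in _ * _ + X - _]big_nat_recl //.
  rewrite !bin0 !subn0.
  (* Pascal's rule: the first sum comes from [F k.+1 l], the second is the tail of the one in
     [F k l.+1]. For [v] below the roles are exchanged, and the extra factor [-1] gives the minus
     sign. *)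
  have -> : \sum_(0 <= i < l.+1) 'C(k.+1 + i.+1, i.+1)%:R * u (l.+1 - i.+1)%N
    = \sum_(0 <= i < l.+1) 'C(k.+1 + i, i)%:R * u (l - i)%N
      + \sum_(0 <= i < l.+1) 'C(k + i.+1, i.+1)%:R * u (l.+1 - i.+1)%N :> R.
    rewrite -big_split; apply: eq_bigr => i _ /=.
    by rewrite subSS addSn binS natrD mulrDl addrC addSnnS.
  have -> : \sum_(0 <= j < k.+1)
      (-1) ^+ j.+1 * 'C(l.+1 + j.+1, j.+1)%:R * v (k.+1 - j.+1)%N
    = \sum_(0 <= j < k.+1) (-1) ^+ j.+1 * 'C(l + j.+1, j.+1)%:R * v (k.+1 - j.+1)%N
      - \sum_(0 <= j < k.+1) (-1) ^+ j * 'C(l.+1 + j, j)%:R * v (k - j)%N :> R.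
    rewrite -sumrB; apply: eq_bigr => j _ /=.
    by rewrite subSS addSn binS natrD exprS addSnnS; ring.
  by rewrite [(-1) ^+ k.+2]exprS; ring.
Qed.

(** The local [hat] of [pascal_descent], indexed by the size [n] of the smaller set, so that the
    removed point is [n.+1]. *)
Definition hat_pascal_descent (n : nat) (J : {fset nat}) : zpoly :=
  if n.+1 \in J then pascal_descent n (J `\ n.+1) * xvar n.+1
  else pascal_descent n J.

Lemma pascal_descent_rec (n : nat) (I : {fset nat}) :
  (1 < #|` I|)%N ->
  pascal_descent n.+1 I =
    hat_pascal_descent n I - hat_pascal_descent n [fset zeta n.+1 j | j in I].
Proof. by rewrite /=; case: (enum_fset I) => [|i [|j s]]. Qed.

Definition translate (s : nat) (A : {fset nat}) : {fset nat} :=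
  [fset (x + s)%N | x in A].

Lemma mem_translate (s : nat) (A : {fset nat}) (y : nat) :
  (y \in translate s A) = (s <= y)%N && ((y - s)%N \in A).
Proof.
apply/imfsetP/andP => [[x /= xA ->]|[sy yA]]; first by rewrite leq_addl addnK.
by exists (y - s)%N => //=; rewrite subnK.
Qed.

Lemma card_translate (s : nat) (A : {fset nat}) : #|` translate s A| = #|` A|.
Proof. by apply: card_imfset => x y /= /addIn. Qed.

Section TranslatedSet.

Variables (C : {fset nat}) (m : nat).
Hypotheses (m_gt0 : (0 < m)%N) (C0 : 0%N \in C) (Cm : m \in C).
Hypothesis C_le : forall x, x \in C -> (x <= m)%N.

Let card_C : (1 < #|` C|)%N.
Proof.
rewrite (cardfsD1 0%N) C0 add1n ltnS (cardfsD1 m) !inE Cm.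
by rewrite -lt0n m_gt0.
Qed.

(** The least element [1] wraps around to [n]; all others move down by one. *)
Lemma zeta_translate1 (n : nat) : (m < n)%N ->
  [fset zeta n j | j in translate 1 C] = n |` (C `\ 0%N).
Proof.
move=> mn; apply/fsetP => y; rewrite !inE; apply/imfsetP/idP => [[x /=]|].
  rewrite mem_translate /zeta => /andP[x1 xC] ->.
  case: (x =P 1%N) => [_|/eqP x1']; first by rewrite eqxx.
  by rewrite -subn1 xC; apply/orP; right; rewrite andbT; lia.
case/orP => [/eqP ->|/andP[y0 yC]].
  by exists 1%N => //=; rewrite mem_translate.
exists y.+1; rewrite /zeta /= ?mem_translate ?subn1 //.
by rewrite eqSS (negPf y0).
Qed.

(** All elements are at least [2], so nothing wraps around. *)
Lemma zeta_translateS (n s : nat) :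
  [fset zeta n j | j in translate s.+2 C] = translate s.+1 C.
Proof.
apply/fsetP => y; rewrite mem_translate.
apply/imfsetP/andP => [[x /=]|[sy yC]].
  rewrite mem_translate /zeta => /andP[sx xC] ->.
  have -> : (x == 1)%N = false by lia.
  have -> : (x.-1 - s.+1 = x - s.+2)%N by lia.
  by split=> //; lia.
exists y.+1; first by rewrite /= mem_translate subSS ltnS sy.
by rewrite /zeta; case: eqP => //=; lia.
Qed.

Lemma notin_translate (n s : nat) : (m + s < n)%N -> (n \in translate s C) = false.
Proof.
by move=> h; rewrite mem_translate; apply/negP => /andP[sn /C_le]; lia.
Qed.

(** The boundary [l = 0]: the maximum of the set is the top point [(k + m).+1]. *)
Lemma hat_translate_max (k : nat) :
  hat_pascal_descent (k + m) (translate k.+1 C)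
  = pascal_descent (k + m) (translate k.+1 (C `\ m)) * xvar (k + m).+1.
Proof.
rewrite /hat_pascal_descent mem_translate.
have -> : ((k + m).+1 - k.+1 = m)%N by lia.
rewrite Cm ltnS leq_addr /=; congr (pascal_descent _ _ * _).
apply/fsetP => y; rewrite !inE !mem_translate !inE.
case: (leqP k.+1 y) => [ky|]; rewrite ?andbF //=; congr (~~ _ && _).
by apply/eqP/eqP; lia.
Qed.

Lemma hat_translate_gap (n s : nat) : (m + s <= n)%N ->
  hat_pascal_descent n (translate s C) = pascal_descent n (translate s C).
Proof. by move=> h; rewrite /hat_pascal_descent notin_translate. Qed.

(** The boundary [k = 0]: the minimum, sent to the top point [n.+1], is then removed by the hat. *)
Lemma hat_zeta_translate1 (n : nat) : (m <= n)%N ->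
  hat_pascal_descent n [fset zeta n.+1 j | j in translate 1 C]
  = pascal_descent n (C `\ 0%N) * xvar n.+1.
Proof.
move=> mn; rewrite zeta_translate1 // /hat_pascal_descent fset1U1 fsetU1K //.
by rewrite !inE; apply/negP => /C_le; lia.
Qed.

Lemma pascal_descent_translate (k l : nat) :
  pascal_descent (k + l + m).+1 (translate k.+1 C) =
    (-1) ^+ k.+1 * (\sum_(0 <= i < l.+1) 'C(k + i, i)%:R *
        (pascal_descent (l - i + m) (C `\ 0%N) * xvar (l - i + m).+1))
    + \sum_(0 <= j < k.+1) (-1) ^+ j * 'C(l + j, j)%:R *
        (pascal_descent (k - j + m) (translate (k - j).+1 (C `\ m))
          * xvar (k - j + m).+1).
Proof.
pose F k l := pascal_descent (k + l + m).+1 (translate k.+1 C).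
(* [u] and [v] are the terms left on the boundaries [k = 0] and [l = 0], as functions of the
   remaining gap. *)
pose u i := pascal_descent (i + m) (C `\ 0%N) * xvar (i + m).+1.
pose v j := pascal_descent (j + m) (translate j.+1 (C `\ m)) * xvar (j + m).+1.
have FE k' l' : F k' l' = hat_pascal_descent (k' + l' + m) (translate k'.+1 C) -
    hat_pascal_descent (k' + l' + m)
      [fset zeta (k' + l' + m).+1 j | j in translate k'.+1 C].
  by rewrite /F pascal_descent_rec // card_translate.
apply: (signed_pascal_recurrence _ F u v) => [|k'|l'|k' l'].
- by rewrite FE addn0 hat_translate_max hat_zeta_translate1 ?leq_addl.
- rewrite FE addn0 hat_translate_max zeta_translateS hat_translate_gap; last lia.
  by rewrite /F addn0.
- rewrite FE hat_zeta_translate1 ?leq_addl // hat_translate_gap; last lia.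
  by [].
- rewrite FE zeta_translateS !hat_translate_gap; try lia.
  by rewrite /F !addnS !addSn.
Qed.

End TranslatedSet.

Theorem theorem5p4 (n d : nat) (a : nat -> nat) (I : {fset nat}) :
  (2 <= d)%N ->
  (forall i j : nat, (1 <= i)%N -> (i < j)%N -> (j <= d)%N -> (a i < a j)%N) ->
  I = [fset a i | i in index_iota 1 d.+1] ->
  I `<` natset n ->
  let k := (a 1 - 1)%N in
  let l := (n - a d)%N in
  let D := [fset (a i - a 1)%N | i in index_iota 2 d.+1] in
  let Dj (j : nat) := [fset (a i - j)%N | i in index_iota 1 d] in
  pascal_descent n I =
    (-1) ^+ (k + 1) *
      \sum_(0 <= i < l.+1)
        'C(k + i, i)%:R * pascal_descent (n - k - 1 - i) D * xvar (n - k - i)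
    + \sum_(0 <= j < k.+1)
        (-1) ^+ j * 'C(l + j, j)%:R * pascal_descent (n - l - 1 - j) (Dj j)
        * xvar (n - l - j).
Proof.
move=> d2 a_lt IE Isub k l D Dj.
have a_le i j : (1 <= i)%N -> (i <= j)%N -> (j <= d)%N -> (a i <= a j)%N.
  by move=> i1; rewrite leq_eqVlt => /orP[/eqP-> //|ij jd]; apply/ltnW/a_lt.
have aI i : (1 <= i <= d)%N -> (1 <= a i <= n)%N.
  move=> id; have : a i \in natset n.
    apply: (fsubsetP (fproper_sub Isub)); rewrite IE; apply/imfsetP.
    by exists i; rewrite //= mem_index_iota ltnS.
  by rewrite !inE mem_index_iota ltnS.
have [a1 ad] : (1 <= a 1 <= n)%N /\ (1 <= a d <= n)%N by split; apply: aI; lia.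
have a1d : (a 1 < a d)%N by apply: a_lt.
pose C := [fset (a i - a 1)%N | i in index_iota 1 d.+1].
pose m := (a d - a 1)%N.
have CP x : reflect (exists2 i, (1 <= i <= d)%N & x = (a i - a 1)%N) (x \in C).
  apply: (iffP idP) => [/imfsetP[i /=]|[i id ->]].
    by rewrite mem_index_iota ltnS => id ->; exists i.
  by apply/imfsetP; exists i; rewrite //= mem_index_iota ltnS.
have m_gt0 : (0 < m)%N by rewrite subn_gt0.
have C0 : 0%N \in C by apply/CP; exists 1%N; lia.
have Cm : m \in C by apply/CP; exists d => //; lia.
have C_le x : x \in C -> (x <= m)%N.
  by case/CP => i /andP[i1 id] ->; apply/leq_sub2r/a_le.
have C_I : I = translate k.+1 C.
  apply/fsetP => y; rewrite IE mem_translate.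
  apply/imfsetP/andP => [[i /=]|[ky /CP[i id yE]]].
    rewrite mem_index_iota ltnS => /andP[i1 id] ->.
    have a1i : (a 1 <= a i)%N by apply: a_le.
    by split; [lia|apply/CP; exists i; lia].
  exists i; first by rewrite /= mem_index_iota ltnS.
  have : (a 1 <= a i)%N by apply: a_le; lia.
  lia.
(* Since [a] is strictly increasing, only the index [1] yields [0]. *)
have C_D : D = C `\ 0%N.
  apply/fsetP => y; rewrite !inE.
  apply/imfsetP/andP => [[i /=]|[y0 /CP[i id yE]]].
    rewrite mem_index_iota ltnS => /andP[i2 id] ->.
    have a1i : (a 1 < a i)%N by apply: a_lt.
    by split; [lia|apply/CP; exists i; lia].
  exists i => //=; rewrite mem_index_iota ltnS.
  suff : i != 1%N by lia.
  by apply: contraNneq y0 => i1; rewrite yE i1 subnn.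
(* The shift is [a 1 - j]; the bound [j <= k] keeps the truncated subtractions exact. *)
have C_Dj j : (j <= k)%N -> Dj j = translate (k - j).+1 (C `\ m).
  move=> jk; apply/fsetP => y; rewrite mem_translate !inE.
  apply/imfsetP/and3P => [[i /=]|[ky ym /CP[i id yE]]].
    rewrite mem_index_iota => /andP[i1 id] ->.
    have a1i : (a 1 <= a i)%N by apply: a_le => //; lia.
    have aid : (a i < a d)%N by apply: a_lt.
    by split; [lia|lia|apply/CP; exists i; lia].
  have a1i : (a 1 <= a i)%N by apply: a_le; lia.
  exists i => /=; last by lia.
  rewrite mem_index_iota; suff : i != d by lia.
  by apply: contraNneq ym => id'; rewrite yE id'.
have nE : n = (k + l + m).+1 by rewrite /k /l /m; lia.
rewrite {1}nE C_I (pascal_descent_translate C m m_gt0 C0 Cm C_le) addn1 C_D.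
(* The index identities below follow from [nE] and the summation bounds [i <= l] and [j <= k]. *)
clearbody k l m.
apply: f_equal2.
  apply: f_equal.
  apply: eq_big_nat => i /andP[_ hi].
  have -> : (n - k - 1 - i = l - i + m)%N by lia.
  have -> : (n - k - i = (l - i + m).+1)%N by lia.
  by rewrite mulrA.
apply: eq_big_nat => j /andP[_ hj].
have -> : (n - l - 1 - j = k - j + m)%N by lia.
have -> : (n - l - j = (k - j + m).+1)%N by lia.
rewrite (C_Dj j hj).
(* Rewriting with [mulrA] would try to match inside [zpoly], unfolding it. *)
exact: mulrA.
Qed.
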